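(* Assume the setting and notation described in the context, and suppose the event $\mathcal{E}$ holds. There exist absolute constants $C_1, C_2>0$ such that the following holds. For any $\gamma\in(0,1)$, if $$ m \ \ge\ C_1 \frac{(1+\theta)^2}{\theta^2 \gamma^2(1-\sqrt{\gamma})^2} \max_{1\le p \le k}p\, s^2(p)\log n, $$ then the final selected support $S^{(k)}$ of the SEP algorithm satisfies $\|\mathbf{v}_{S^{(k)}}\|_2\ge \sqrt{\gamma}$, and the output $\hat{\mathbf{v}}$ of SEP satisfies $$ \sin\angle(\hat{\mathbf{v}},\mathbf{v})\ \le\ \sqrt{1-\gamma} + \frac{C_2(1+\theta)}{\theta \gamma}\sqrt{\frac{k\log n}{m}}. $$
   Context: Let $n\ge 2$, $m\ge 1$, $\theta>0$, $k\in\{1,\dots,n\}$. Let $\mathbf{v}\in\mathbb{R}^n$ with $\|\mathbf{v}\|_2=1$ and at most $k$ nonzero entries. Let $\mathbf{x}_1,\dots,\mathbf{x}_m$ be i.i.d. $\mathcal{N}(\mathbf{0},\boldsymbol{\Sigma})$ with $\boldsymbol{\Sigma}=\mathbf{I}_n+\theta\mathbf{v}\mathbf{v}^\top$. Put $\hat{\boldsymbol{\Sigma}}=\frac1m\sum_{i=1}^m\mathbf{x}_i\mathbf{x}_i^\top$, $\hat{\boldsymbol{\Gamma}}=\hat{\boldsymbol{\Sigma}}-\mathbf{I}_n$, and $\mathbf{W}=\hat{\boldsymbol{\Gamma}}-\theta\mathbf{v}\mathbf{v}^\top$. For $S,U\subseteq[n]=\{1,\dots,n\}$, $\mathbf{A}_{S,U}$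 is the submatrix with rows in $S$ and columns in $U$, and $\mathbf{v}_S$ is the restriction of $\mathbf{v}$ to $S$. $\|\cdot\|_2$ is the Euclidean norm for vectors and the spectral norm for matrices. Let $v_{(1)}\ge v_{(2)}\ge\cdots$ be the absolute values of the entries of $\mathbf{v}$ sorted decreasingly, and define the structure function $s(p)=\big(\sum_{i=1}^p v_{(i)}^2\big)^{-1}$ for $1\le p\le k$. For unit vectors $\mathbf{a},\mathbf{b}$, $\sin\angle(\mathbf{a},\mathbf{b})=\sqrt{1-\langle\mathbf{a},\mathbf{b}\rangle^2}$. Fix an absolute constant $C_0>0$; the event $\mathcal{E}$ is: for every $p\in[n]$ and every $S\subseteq[n]$ with $|S|=p$, $\|\mathbf{W}_{S,S}\|_2\le C_0(1+\theta)\sqrt{p\log n/m}$. ''Absolute constant'' means a number not depending on $n,m,k,\theta,\mathbf{v},\gamma$. SEP algorithm (input $\hat{\boldsymbol{\Gamma}}$ and $k$): set $S^{(1)}=\{j^\ast\}$ where $j^\ast$ maximizes $|\hat{\boldsymbol{\Gamma}}_{jj}|$. For $p=1,\dots,k-1$: let $\hat{\mathbf{e}}^{(p)}$ be a unit eigenvector for the largest eigenvalue of $\hat{\boldsymbol{\Gamma}}_{S^{(p)},S^{(p)}}$, zero-padded to $\mathbb{R}^n$; let $\mathbf{u}^{(p)}=\hat{\boldsymbol{\Gamma}}\hat{\mathbf{e}}^{(p)}$; let $S^{(p+1)}$ be the indices of the $p+1$ largest entries of $|\mathbf{u}^{(p)}|$. Output $\hat{\mathbf{v}}$: a unit eigenvector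 for the largest eigenvalue of $\hat{\boldsymbol{\Gamma}}_{S^{(k)},S^{(k)}}$, zero-padded to $\mathbb{R}^n$. *)

(* Defs.v *)
From HB Require Import structures.
From mathcomp Require Import all_boot all_order all_algebra.
From mathcomp Require Import reals exp.
Set Implicit Arguments. Unset Strict Implicit. Unset Printing Implicit Defensive.
Import Order.TTheory GRing.Theory Num.Theory.
Local Open Scope ring_scope.

Section Defs.
Variable R : realType.
Variable n : nat.

Definition vnorm (x : 'cV[R]_n) : R := Num.sqrt (\sum_i x i 0 ^+ 2).

Definition vdot (x y : 'cV[R]_n) : R := \sum_i x i 0 * y i 0.

(* restriction v_S of v to S (as a vector of R^S, zero-padded is the same norm) *)
Definition restr (S : {set 'I_n}) (x : 'cV[R]_n) : 'cV[R]_n :=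
  \col_i (if i \in S then x i 0 else 0).

Definition subS (A : 'M[R]_n) (S : {set 'I_n}) : 'M[R]_#|S| :=
  \matrix_(i, j) A (enum_val i) (enum_val j).

Definition subv (S : {set 'I_n}) (x : 'cV[R]_n) : 'cV[R]_#|S| :=
  \col_i x (enum_val i) 0.

Definition vnormS (S : {set 'I_n}) (y : 'cV[R]_#|S|) : R :=
  Num.sqrt (\sum_i y i 0 ^+ 2).

Definition specnorm_le (A : 'M[R]_n) (S : {set 'I_n}) (c : R) : Prop :=
  forall y : 'cV[R]_#|S|, vnormS (subS A S *m y) <= c * vnormS y.

Definition top_eigvec_padded (A : 'M[R]_n) (S : {set 'I_n}) (e : 'cV[R]_n)
  : Prop :=
  exists (u : 'cV[R]_#|S|) (lam : R),
    [/\ subS A S *m u = lam *: u,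
        (forall mu : R, eigenvalue (subS A S) mu -> mu <= lam),
        vnormS u = 1,
        (forall i : 'I_#|S|, e (enum_val i) 0 = u i 0) &
        (forall j : 'I_n, j \notin S -> e j 0 = 0)].

Definition Gammahat (m : nat) (x : 'I_m -> 'cV[R]_n) : 'M[R]_n :=
  (m%:R)^-1 *: (\sum_(i < m) (x i *m (x i)^T)) - 1%:M.

Definition Wmat (m : nat) (x : 'I_m -> 'cV[R]_n) (theta : R) (v : 'cV[R]_n)
  : 'M[R]_n := Gammahat x - theta *: (v *m v^T).

Definition eventE (C0 : R) (m : nat) (x : 'I_m -> 'cV[R]_n) (theta : R)
  (v : 'cV[R]_n) : Prop :=
  forall S : {set 'I_n}, (0 < #|S|)%N ->
    specnorm_le (Wmat x theta v) S
      (C0 * (1 + theta) * Num.sqrt (#|S|%:R * ln (n%:R) / m%:R)).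

Definition sorted_abs (v : 'cV[R]_n) : seq R :=
  sort (fun a b => b <= a) [seq `|v i 0| | i <- enum 'I_n].

Definition sfun (v : 'cV[R]_n) (p : nat) : R :=
  (\sum_(i < p) (nth 0 (sorted_abs v) i) ^+ 2)^-1.

(* SEP algorithm, relational: any admissible choices (ties, eigenvector
   choice) form a run.  Ssup p = S^{(p)} for 1 <= p <= k. *)
Definition SEP_run (G : 'M[R]_n) (k : nat) (Ssup : nat -> {set 'I_n})
  (vhat : 'cV[R]_n) : Prop :=
  [/\ exists jstar : 'I_n,
        Ssup 1%N = [set jstar] /\ (forall j : 'I_n, `|G j j| <= `|G jstar jstar|),
      (forall p : nat, (1 <= p)%N -> (p <= k - 1)%N ->
         exists ehat : 'cV[R]_n,
           top_eigvec_padded G (Ssup p) ehat /\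
           let u := G *m ehat in
           #|Ssup p.+1| = p.+1 /\
           (forall i j : 'I_n, i \in Ssup p.+1 -> j \notin Ssup p.+1 ->
              `|u j 0| <= `|u i 0|)) &
      top_eigvec_padded G (Ssup k) vhat].

End Defs.

(* Main.v *)
Require Import Defs.
From HB Require Import structures.
From mathcomp Require Import all_boot all_order all_algebra.
From mathcomp Require Import ring lra zify.
From mathcomp Require Import reals exp.
From mathcomp Require boolp classical_sets topology normedtype derive.
Set Implicit Arguments. Unset Strict Implicit. Unset Printing Implicit Defensive.
Import Order.TTheory GRing.Theory Num.Theory.
Local Open Scope ring_scope.

(* The restriction of W to a set of at most 4p coordinates has norm at most
   2 eps(p), where eps(p) = C0 (1 + theta) sqrt (p ln n / m), and the lower bound
   on m, with C1 = 64 C0^2, says that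
   eps(p) <= theta gamma (1 - sqrt gamma) / (8 s(p)).
   One shows by induction on p that S^(p) carries at least the fraction gamma of
   the largest possible mass 1 / s(p): by the Rayleigh quotient at v_S the top
   eigenvector e satisfies theta <v, e>^2 >= theta |v_S|^2 - 2 eps(p), so in
   u = theta <v, e> v + W e the noise on S^(p) together with p + 1 other
   coordinates is too small for the selection of the p + 1 largest entries to
   lose more than the factor gamma.  At p = k one has s(k) = 1, and the angle is
   bounded by a Davis-Kahan argument inside S^(k). *)

(** * Euclidean inner product and norm *)

Section Vdot.
Variables (R : realType) (n : nat).
Implicit Types (x y z : 'cV[R]_n) (a : R) (A : 'M[R]_n).

Lemma vdotC x y : vdot x y = vdot y x.
Proof. by apply: eq_bigr => i _; rewrite mulrC. Qed.

Lemma vdotDl x y z : vdot (x + y) z = vdot x z + vdot y z.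
Proof. by rewrite -big_split; apply: eq_bigr => i _; rewrite mxE mulrDl. Qed.

Lemma vdotZl a x y : vdot (a *: x) y = a * vdot x y.
Proof. by rewrite big_distrr; apply: eq_bigr => i _; rewrite mxE -mulrA. Qed.

Lemma vdotDr x y z : vdot x (y + z) = vdot x y + vdot x z.
Proof. by rewrite vdotC vdotDl !(vdotC x). Qed.

Lemma vdotZr a x y : vdot x (a *: y) = a * vdot x y.
Proof. by rewrite vdotC vdotZl vdotC. Qed.

Lemma vdotNl x y : vdot (- x) y = - vdot x y.
Proof. by rewrite -scaleN1r vdotZl mulN1r. Qed.

Lemma vdotNr x y : vdot x (- y) = - vdot x y.
Proof. by rewrite vdotC vdotNl vdotC. Qed.

Definition vdotE := (vdotDl, vdotDr, vdotZl, vdotZr, vdotNl, vdotNr).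

Lemma vdot0l x : vdot 0 x = 0.
Proof. by rewrite -(scale0r 0) vdotZl mul0r. Qed.

Lemma vdot_mxE x y : vdot x y = (x^T *m y) 0 0.
Proof. by rewrite mxE; apply: eq_bigr => i _; rewrite mxE. Qed.

Lemma vdot_mulmxr A x y : vdot x (A *m y) = vdot (A^T *m x) y.
Proof. by rewrite !vdot_mxE trmx_mul trmxK mulmxA. Qed.

Lemma vdotxx x : vdot x x = \sum_i x i 0 ^+ 2.
Proof. by apply: eq_bigr => i _; rewrite expr2. Qed.

Lemma vdotxx_ge0 x : 0 <= vdot x x.
Proof. by rewrite vdotxx sumr_ge0 // => i _; rewrite sqr_ge0. Qed.

Lemma vdotxx_eq0 x : vdot x x = 0 -> x = 0.
Proof.
rewrite vdotxx => /eqP; rewrite psumr_eq0 => [/allP x0|i _]; last exact: sqr_ge0.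
apply/colP => i; rewrite mxE; apply/eqP; rewrite -sqrf_eq0.
exact: x0 (mem_index_enum i).
Qed.

Lemma vnormE x : vnorm x = Num.sqrt (vdot x x).
Proof. by rewrite vdotxx. Qed.

Lemma vnorm_ge0 x : 0 <= vnorm x.
Proof. exact: sqrtr_ge0. Qed.

Lemma sqr_vnorm x : vnorm x ^+ 2 = vdot x x.
Proof. by rewrite vnormE sqr_sqrtr // vdotxx_ge0. Qed.

Lemma vnormZ a x : vnorm (a *: x) = `|a| * vnorm x.
Proof.
by rewrite !vnormE !vdotE mulrA -expr2 sqrtrM ?sqr_ge0 // sqrtr_sqr.
Qed.

Lemma vnorm_eq0 x : vnorm x = 0 -> x = 0.
Proof. by move=> x0; apply: vdotxx_eq0; rewrite -sqr_vnorm x0 expr0n. Qed.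

(** Cauchy-Schwarz: the squared norm of [vnorm y *: x - vnorm x *: y] is nonnegative, and its
    expansion is divided by [vnorm x * vnorm y]. *)
Lemma vdot_le_vnorm x y : vdot x y <= vnorm x * vnorm y.
Proof.
have [x0|x0] := eqVneq (vnorm x) 0.
  by rewrite x0 mul0r (vnorm_eq0 x0) vdot0l.
have [y0|y0] := eqVneq (vnorm y) 0.
  by rewrite y0 mulr0 (vnorm_eq0 y0) vdotC vdot0l.
have xy_gt0 : 0 < vnorm x * vnorm y by rewrite mulr_gt0 // lt_def vnorm_ge0 ?x0 ?y0.
have := vdotxx_ge0 (vnorm y *: x - vnorm x *: y).
rewrite !vdotE -!sqr_vnorm (vdotC y x) => h.
by rewrite -(ler_pM2l xy_gt0); nra.
Qed.

Lemma norm_vdot_le x y : `|vdot x y| <= vnorm x * vnorm y.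
Proof.
rewrite ler_norml vdot_le_vnorm andbT.
have := vdot_le_vnorm (- x) y.
by rewrite -scaleN1r vnormZ vdotZl normrN1; lra.
Qed.

Lemma vnormD x y : vnorm (x + y) <= vnorm x + vnorm y.
Proof.
rewrite -(@ler_pXn2r _ 2) ?nnegrE ?addr_ge0 ?vnorm_ge0 //.
rewrite sqr_vnorm !vdotE -!sqr_vnorm (vdotC y x).
by have := vdot_le_vnorm x y; lra.
Qed.

End Vdot.

(** * Rayleigh quotients: existence of a maximizer and the top eigenvalue *)

Section Rayleigh.
Variables (R : realType) (n : nat).
Implicit Types (x y z : 'cV[R]_n) (A : 'M[R]_n).
Import boolp classical_sets topology normedtype derive numFieldNormedType.Exports.
Local Open Scope classical_set_scope.

Lemma continuous_quadratic_form A :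
  continuous (fun w : 'rV[R]_n => vdot w^T (A *m w^T)).
Proof.
have cont_coord i : continuous (fun w : 'rV[R]_n => w^T i 0).
  rewrite (_ : (fun _ => _) = fun w : 'rV[R]_n => w 0 i).
    exact: coord_continuous.
  by apply/funext => w; rewrite mxE.
apply: continuous_big; first exact: add_continuous.
move=> i _ w; apply: continuousM; first exact: cont_coord.
rewrite (_ : (fun _ => _) = fun w : 'rV[R]_n => \sum_j A i j * w^T j 0).
  move: w; apply: continuous_big; first exact: add_continuous.
  by move=> j _ w; apply: continuousM; [exact: cst_continuous|exact: cont_coord].
by apply/funext => z; rewrite mxE.
Qed.

(** Heine-Borel on row vectors: the sphere is closed as the preimage of 1 under a continuous form,
    and each coordinate is bounded by the norm. *)
Lemma compact_unit_sphere : compact [set w : 'rV[R]_n | vdot w^T w^T = 1].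
Proof.
apply: bounded_closed_compact; last first.
  apply: (@preimage_closed _ _ (fun w : 'rV[R]_n => vdot w^T w^T) [set 1]).
    move=> w _.
    rewrite (_ : (fun _ => _) = fun w : 'rV[R]_n => vdot w^T (1%:M *m w^T)).
      exact: continuous_quadratic_form.
    by apply/funext => ?; rewrite mul1mx.
  exact: closed_eq.
exists 1; split => // M M1 w /= w1.
rewrite /Num.norm /= mx_normrE; apply/bigmax_leP; split => [|[i j] _ /=]; first lra.
rewrite ord1; apply: le_trans (ltW M1).
rewrite -[leRHS]sqrtr1 -w1 vdotxx -sqrtr_sqr ler_sqrt ?sumr_ge0 //; last first.
  by move=> ? _; rewrite sqr_ge0.
rewrite (bigD1 j) //= mxE lerDl sumr_ge0 // => ? _; exact: sqr_ge0.
Qed.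

(** The quadratic form attains its maximum on the compact sphere, and homogeneity of degree 2
    carries the bound to all [z]. The vector [x] only shows that the sphere is nonempty. *)
Lemma unit_sphere_argmax A x : x != 0 ->
  exists2 y, vdot y y = 1 &
    forall z, vdot z (A *m z) <= vdot y (A *m y) * vdot z z.
Proof.
have normalize z : z != 0 ->
  vdot ((vnorm z)^-1 *: z) ((vnorm z)^-1 *: z) = 1.
  move=> z0; rewrite !vdotE -sqr_vnorm.
  by field; apply: contraNneq z0 => /vnorm_eq0->.
move=> x0.
have [|w w1 wmax] := compact_EVT_max _ compact_unit_sphere
    (continuous_subspaceT (@continuous_quadratic_form A)).
  by exists ((vnorm x)^-1 *: x)^T; rewrite /= trmxK normalize.
exists w^T => [|z]; first by rewrite inE in w1.
have [->|z0] := eqVneq z 0; first by rewrite !vdot0l mulr0.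
have := wmax ((vnorm z)^-1 *: z)^T; rewrite inE /= trmxK normalize // => /(_ erefl).
rewrite -scalemxAr !vdotE mulrA -expr2 exprVn sqr_vnorm => h.
by rewrite -ler_pdivrMr 1?mulrC // lt_def vdotxx_ge0 andbT; apply: contraNneq z0 => /vdotxx_eq0->.
Qed.

(* A maximizer y of the Rayleigh quotient is an eigenvector: the quadratic
   form [vdot y (A *m y) * vdot z z - vdot z (A *m z)] is nonnegative and
   vanishes at y, so perturbing y along the residual shows the residual is 0. *)
Lemma rayleigh_le A (lam : R) x : A^T = A ->
  (forall mu, eigenvalue A mu -> mu <= lam) -> vdot x (A *m x) <= lam * vdot x x.
Proof.
move=> Asym Alam.
have [->|x0] := eqVneq x 0; first by rewrite !vdot0l mulr0.
have [y y1 ymax] := unit_sphere_argmax A x0.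
apply: le_trans (ymax x) _; apply: ler_wpM2r; first exact: vdotxx_ge0.
apply: Alam; set M := vdot y (A *m y) in ymax *.
have [r rE] : exists r, r = A *m y - M *: y by eexists.
have r0 : r = 0.
  apply: vdotxx_eq0; apply/eqP; rewrite eq_le vdotxx_ge0 andbT.
  have key t : 2 * t * vdot r r <= t ^+ 2 * (M * vdot r r - vdot r (A *m r)).
    have := ymax (y + t *: r).
    have Ary : vdot y (A *m r) = vdot r (A *m y) by rewrite vdot_mulmxr Asym vdotC.
    rewrite mulmxDr -scalemxAr !vdotE y1 -/M Ary (vdotC y r).
    have -> : vdot r r = vdot r (A *m y) - M * vdot r y.
      by rewrite {2}rE !vdotE.
    by lra.
  set K := _ - _ in key.
  have rr0 := vdotxx_ge0 r.
  (* For [K > 0] the choice [t = vdot r r / K] turns [key] into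
     [2 * vdot r r ^+ 2 <= vdot r r ^+ 2]; for [K <= 0] already [t = 1] suffices. *)
  have [K0|K0] := ltP 0 K.
    have := key (vdot r r / K); rewrite -(ler_pM2r K0).
    have -> : 2 * (vdot r r / K) * vdot r r * K = 2 * vdot r r ^+ 2.
      by field; rewrite gt_eqF.
    have -> : (vdot r r / K) ^+ 2 * K * K = vdot r r ^+ 2.
      by field; rewrite gt_eqF.
    by nra.
  by have := key 1; lra.
apply/eigenvalueP; exists y^T; last first.
  rewrite trmx_eq0; apply/eqP => y0; move: y1; rewrite y0 vdot0l => /eqP.
  by rewrite eq_sym oner_eq0.
by rewrite -{1}Asym -trmx_mul -linearZ /=; congr trmx; apply/eqP; rewrite -subr_eq0 -rE r0.
Qed.

End Rayleigh.

(** * Passing between submatrices and zero-padded vectors *)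

Section Restriction.
Variables (R : realType) (n : nat).
Implicit Types (x y z : 'cV[R]_n) (A : 'M[R]_n) (S U : {set 'I_n}) (c : R).

Definition supported S x := forall j, j \notin S -> x j 0 = 0.

Lemma supportedW S U x : S \subset U -> supported S x -> supported U x.
Proof. by move=> /subsetP SU Sx j jU; apply: Sx; apply: contra jU => /SU. Qed.

Lemma supportedD S x y : supported S x -> supported S y -> supported S (x + y).
Proof. by move=> Sx Sy j jS; rewrite mxE Sx // Sy // addr0. Qed.

Lemma supportedZ S c x : supported S x -> supported S (c *: x).
Proof. by move=> Sx j jS; rewrite mxE Sx // mulr0. Qed.

Lemma restr_supported S x : supported S (restr S x).
Proof. by move=> j jS; rewrite mxE (negbTE jS). Qed.

Lemma restrD S x y : restr S (x + y) = restr S x + restr S y.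
Proof. by apply/colP => i; rewrite !mxE; case: ifP; rewrite ?addr0. Qed.

Lemma restrZ S c x : restr S (c *: x) = c *: restr S x.
Proof. by apply/colP => i; rewrite !mxE; case: ifP; rewrite ?mulr0. Qed.

Lemma vdot_restrl S x y : vdot (restr S x) y = \sum_(i in S) x i 0 * y i 0.
Proof.
rewrite [RHS]big_mkcond; apply: eq_bigr => i _.
by rewrite mxE; case: ifP; rewrite ?mul0r.
Qed.

Lemma vdot_restr_supported S x y : supported S y -> vdot (restr S x) y = vdot x y.
Proof.
move=> Sy; apply: eq_bigr => i _; rewrite mxE.
by case: ifPn => // /Sy ->; rewrite !mulr0.
Qed.

Lemma vdotxx_restr S x : vdot (restr S x) (restr S x) = \sum_(i in S) x i 0 ^+ 2.
Proof. by rewrite vdot_restrl; apply: eq_bigr => i iS; rewrite mxE iS expr2. Qed.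

Lemma vdot_subv S x y : supported S x -> vdot (subv S x) (subv S y) = vdot x y.
Proof.
move=> Sx; rewrite -[RHS]vdotC -(vdot_restr_supported y Sx) vdot_restrl.
by rewrite big_enum_val /=; apply: eq_bigr => i _; rewrite !mxE mulrC.
Qed.

Lemma vnorm_subv S x : supported S x -> vnorm (subv S x) = vnorm x.
Proof. by move=> Sx; rewrite !vnormE vdot_subv. Qed.

Lemma subS_subv A S x : supported S x -> subS A S *m subv S x = subv S (A *m x).
Proof.
move=> Sx; apply/colP => i; rewrite !mxE [RHS](bigID (mem S)) /=.
rewrite [X in _ + X]big1 ?addr0 => [|j /Sx->]; last by rewrite mulr0.
by rewrite [RHS]big_enum_val /=; apply: eq_bigr => j _; rewrite !mxE.
Qed.

(** Bilinear form of the spectral bound: Cauchy-Schwarz inside the block, with vectors kept in the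
    ambient space. *)
Lemma specnorm_le_vdot A S c x y : specnorm_le A S c ->
  supported S x -> supported S y -> `|vdot x (A *m y)| <= c * vnorm x * vnorm y.
Proof.
move=> Ac Sx Sy; rewrite -(vdot_subv _ Sx) -subS_subv //.
apply: le_trans (norm_vdot_le _ _) _.
rewrite -(vnorm_subv Sx) -(vnorm_subv Sy) mulrAC [c * _ * _]mulrC.
by rewrite ler_wpM2l ?vnorm_ge0 //; apply: Ac.
Qed.

(** Duality: the bilinear bound is tested against [z = restr S (A *m y)] itself, for which the
    pairing equals [vnorm z ^+ 2]. *)
Lemma vnorm_restr_mulmx A S U c y : specnorm_le A U c -> 0 <= c ->
  S \subset U -> supported U y -> vnorm (restr S (A *m y)) <= c * vnorm y.
Proof.
move=> Ac c0 SU Uy; set z := restr S _.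
have [z0|z0] := eqVneq (vnorm z) 0; first by rewrite z0 mulr_ge0 ?vnorm_ge0.
have zgt0 : 0 < vnorm z by rewrite lt_def z0 vnorm_ge0.
have Uz : supported U z by apply: supportedW SU _; exact: restr_supported.
have := le_trans (ler_norm _) (specnorm_le_vdot Ac Uz Uy).
have -> : vdot z (A *m y) = vnorm z ^+ 2.
  rewrite sqr_vnorm [LHS]vdotC.
  by rewrite -(vdot_restr_supported (A *m y) (@restr_supported S (A *m y))).
by move=> h; rewrite -(ler_pM2l zgt0); lra.
Qed.

(** The eigenvalue equation of the block becomes an identity against test vectors supported on [S],
    so later estimates need no submatrices. The last clause is [rayleigh_le] for the symmetric
    block. *)
Lemma top_eigvec_paddedP A S y : A^T = A -> top_eigvec_padded A S y ->
  exists lam, [/\ supported S y, vnorm y = 1,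
    forall x, supported S x -> vdot x (A *m y) = lam * vdot x y &
    forall x, supported S x -> vdot x (A *m x) <= lam * vdot x x].
Proof.
move=> Asym [u [lam [uE lamtop u1 yu Sy]]].
have {}yu : subv S y = u by apply/colP => i; rewrite mxE yu.
subst u; exists lam; split => //.
- by rewrite -(vnorm_subv Sy).
- by move=> x Sx; rewrite -(vdot_subv _ Sx) -subS_subv // uE vdotZr vdot_subv.
- move=> x Sx; rewrite -!(vdot_subv _ Sx) -subS_subv //; apply: rayleigh_le => //.
  by apply/matrixP => i j; rewrite !mxE -[A in LHS]Asym mxE.
Qed.

End Restriction.

(** * Sets of largest values *)

Section TopSets.
Variables (R : realType) (I : finType).
Implicit Types (A B : {set I}) (f : I -> R).

Definition top_set f B := forall i j, i \in B -> j \notin B -> f j <= f i.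

(** Exchange argument: the common part cancels, [A :\: B] has no more elements than [B :\: A], and
    the maximum of [f] on the former is below every value on the latter. *)
Lemma sum_le_top_set f A B : (forall i, 0 <= f i) -> top_set f B ->
  (#|A| <= #|B|)%N -> \sum_(i in A) f i <= \sum_(i in B) f i.
Proof.
move=> f0 Btop AB.
rewrite (big_setID B) [leRHS](big_setID A) /= setIC lerD2l.
have DAB : (#|A :\: B| <= #|B :\: A|)%N.
  by rewrite -(leq_add2l #|A :&: B|) cardsID [A :&: B]setIC cardsID.
have [->|[j0 j0AB]] := set_0Vmem (A :\: B).
  by rewrite big_set0 sumr_ge0.
have [j jAB jmax] := @arg_maxP _ _ _ j0 (mem (A :\: B)) f j0AB.
apply: (@le_trans _ _ (f j *+ #|A :\: B|)).
  rewrite -sumr_const; apply: ler_sum => i iAB; exact: jmax.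
apply: (@le_trans _ _ (f j *+ #|B :\: A|)); first exact: ler_wpMn2l.
rewrite -sumr_const; apply: ler_sum => i.
rewrite inE => /andP[_ iB]; apply: Btop => //.
by case/setDP: jAB.
Qed.

End TopSets.

(** * Sorted entries as a sum over a top set *)

Section SortedAbs.
Variables (R : realType) (n : nat).
Implicit Type v : 'cV[R]_n.

(** Sorting the indices rather than the values remembers positions: the first [p] indices form [B],
    and mapping them to absolute values recovers the prefix of [sorted_abs v]. *)
Lemma sorted_abs_top_set v p : (p <= n)%N ->
  exists B : {set 'I_n}, [/\ #|B| = p, top_set (fun i => v i 0 ^+ 2) B &
    \sum_(i in B) v i 0 ^+ 2 = (sfun v p)^-1].
Proof.
move=> pn; pose e := relpre (fun i : 'I_n => `|v i 0|) (fun a b => b <= a).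
pose s := sort e (enum 'I_n).
have us : uniq s by rewrite sort_uniq enum_uniq.
have ss : size s = n by rewrite size_sort size_enum_ord.
have sB : size (take p s) = p by rewrite size_takel ?ss.
exists [set i in take p s]; split.
- by rewrite cardsE (card_uniqP _) ?take_uniq.
- move=> i j; rewrite !inE => ip jp.
  have js : j \in drop p s.
    by have := mem_enum 'I_n j; rewrite -(mem_sort e) -/s -{1}(cat_take_drop p s) mem_cat (negbTE jp).
  have e_trans : transitive e by move=> a b c /= ab bc; apply: le_trans ab.
  have : sorted e s by apply: sort_sorted => a b; exact: le_total.
  rewrite sorted_pairwise // -(cat_take_drop p s) pairwise_cat => /andP[/allrelP h _].
  rewrite -[leLHS]real_normK ?num_real // -[leRHS]real_normK ?num_real //.
  by rewrite ler_sqr ?nnegrE //; exact: h ip js.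
- transitivity (\sum_(i <- take p s) v i 0 ^+ 2).
    by rewrite [RHS]big_uniq ?take_uniq //=; apply: eq_bigl => i; rewrite inE.
  transitivity (\sum_(a <- take p (sorted_abs v)) a ^+ 2).
    rewrite /sorted_abs sort_map -map_take big_map.
    by apply: eq_bigr => i _; rewrite real_normK ?num_real.
  (* Since [p <= n], every index is inside the list and the default value 0 of [nth] never
     enters. *)
  rewrite /sfun invrK (big_nth 0) size_takel.
    by rewrite big_mkord; apply: eq_bigr => i _; rewrite nth_take.
  by rewrite size_sort size_map size_enum_ord.
Qed.

End SortedAbs.

(** * The inverse structure function as the maximal mass on [p] coordinates *)

Section StructureFunction.
Variables (R : realType) (n : nat) (v : 'cV[R]_n).
Hypothesis v1 : vdot v v = 1.

Lemma restr_mass_le (A : {set 'I_n}) p : (#|A| <= p)%N -> (p <= n)%N ->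
  vdot (restr A v) (restr A v) <= (sfun v p)^-1.
Proof.
move=> Ap pn; have [B [cB topB <-]] := sorted_abs_top_set v pn.
rewrite vdotxx_restr; apply: sum_le_top_set; rewrite ?cB //.
by move=> i; apply: sqr_ge0.
Qed.

Lemma sfun_inv_gt0 p : (0 < p)%N -> (p <= n)%N -> 0 < (sfun v p)^-1.
Proof.
move=> p0 pn; have [i vi] : exists i, v i 0 != 0.
  apply/existsP; apply: contraT; rewrite negb_exists => /forallP v0.
  have : v = 0 by apply/colP => i; rewrite mxE; apply/eqP; move: (v0 i); rewrite negbK.
  by move=> v0'; move: v1; rewrite v0' vdot0l => /eqP; rewrite eq_sym oner_eq0.
have := @restr_mass_le [set i] p; rewrite cards1 => /(_ p0 pn).
apply: lt_le_trans; rewrite vdotxx_restr big_set1.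
by rewrite lt_def sqrf_eq0 vi sqr_ge0.
Qed.

Lemma sfun_inv_le p q : (p <= q)%N -> (q <= n)%N -> (sfun v p)^-1 <= (sfun v q)^-1.
Proof.
move=> pq qn; have [B [cB _ <-]] := sorted_abs_top_set v (leq_trans pq qn).
by rewrite -vdotxx_restr restr_mass_le // cB.
Qed.

(** The support of [v] is a competitor of size at most [k] and already carries the whole unit
    mass. *)
Lemma sfun_inv_eq1 k : (k <= n)%N -> (#|[set i | (v i ord0 != 0)%R]| <= k)%N ->
  (sfun v k)^-1 = 1.
Proof.
move=> kn vk; apply/eqP; rewrite eq_le; apply/andP; split.
  have [B [_ _ <-]] := sorted_abs_top_set v kn.
  rewrite -v1 vdotxx [leRHS](bigID (mem B)) /= lerDl sumr_ge0 // => i _.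
  exact: sqr_ge0.
have := restr_mass_le vk kn; rewrite vdotxx_restr; apply: le_trans.
rewrite -v1 vdotxx [leLHS](bigID (mem [set i | (v i ord0 != 0)%R])) /=.
rewrite [X in _ + X]big1 ?addr0 // => i.
by rewrite inE negbK => /eqP->; rewrite expr0n.
Qed.

End StructureFunction.

(** * Deterministic perturbation bounds for a rank-one spike plus noise *)

Section Spike.
Variables (R : realType) (n : nat) (v : 'cV[R]_n) (theta : R) (G W : 'M[R]_n).
Hypotheses (theta_gt0 : 0 < theta) (Gsym : G^T = G) (v1 : vdot v v = 1).
Hypothesis GW : G = theta *: (v *m v^T) + W.
Implicit Types (x y e z : 'cV[R]_n) (S T : {set 'I_n}).

Lemma spike_mulmx y : G *m y = (theta * vdot v y) *: v + W *m y.
Proof.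
rewrite GW mulmxDl -scalemxAl -mulmxA; congr (_ + _).
rewrite [v^T *m y]mx11_scalar mul_mx_scalar scalerA; congr (_ * _ *: _).
by rewrite vdot_mxE.
Qed.

Lemma spike_diag j : G j j = theta * v j 0 ^+ 2 + W j j.
Proof. by rewrite GW !mxE big_ord1 !mxE -expr2. Qed.

Lemma specnorm_le_diag S c j : specnorm_le W S c -> j \in S -> `|W j j| <= c.
Proof.
move=> Wc jS; pose d : 'cV[R]_n := delta_mx j 0.
have dS : supported S d.
  by move=> i; rewrite mxE andbT; case: eqP => // ->; rewrite jS.
have dx x : vdot d x = x j 0.
  rewrite /vdot (bigD1 j) //= mxE !eqxx mul1r big1 ?addr0 // => i /negbTE ij.
  by rewrite mxE ij mul0r.
have := specnorm_le_vdot Wc dS dS.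
have dj : d j 0 = 1 by rewrite mxE !eqxx.
by rewrite vnormE !dx dj sqrtr1 !mulr1 -colE mxE.
Qed.

(** The lower bound on [lam] is the Rayleigh quotient at [restr S v], divided by its squared norm;
    the upper bound comes from evaluating the form at [e]. *)
Lemma spike_top_eigvec S e c : top_eigvec_padded G S e ->
  specnorm_le W S c -> 0 < vdot (restr S v) (restr S v) ->
  exists lam, [/\ supported S e, vnorm e = 1,
    forall x, supported S x -> vdot x (G *m e) = lam * vdot x e,
    theta * vdot (restr S v) (restr S v) - c <= lam &
    lam <= theta * vdot v e ^+ 2 + c].
Proof.
move=> /(top_eigvec_paddedP Gsym)[lam [Se e1 eig ray]] Wc.
set w := restr S v => w0; exists lam.
have Sw : supported S w by exact: restr_supported.
have vw : vdot v w = vdot w w by rewrite -[LHS](vdot_restr_supported v Sw).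
split=> //.
- have := ray w Sw; rewrite spike_mulmx !vdotE [vdot w v]vdotC vw => h.
  have := specnorm_le_vdot Wc Sw Sw; rewrite -mulrA -expr2 sqr_vnorm.
  rewrite ler_norml => /andP[h' _].
  by rewrite -(ler_pM2r w0); lra.
- have := eig e Se; rewrite spike_mulmx !vdotE [vdot e v]vdotC.
  have := specnorm_le_vdot Wc Se Se; rewrite e1 !mulr1 -sqr_vnorm e1 expr1n.
  by rewrite ler_norml => /andP[_ h] h'; lra.
Qed.

(** The selection gives [vnorm (restr T u) <= vnorm (restr S u)]; replacing [u] by its signal part
    costs one [eta] on each side. *)
Lemma spike_select S T u z c eta : u = c *: v + z ->
  top_set (fun i => `|u i 0|) S -> (#|T| <= #|S|)%N ->
  vnorm (restr T z) <= eta -> vnorm (restr S z) <= eta ->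
  `|c| * vnorm (restr T v) <= `|c| * vnorm (restr S v) + eta *+ 2.
Proof.
move=> uE topS TS Tz Sz.
have uTS : vnorm (restr T u) <= vnorm (restr S u).
  rewrite !vnormE ler_sqrt ?vdotxx_ge0 // !vdotxx_restr.
  apply: sum_le_top_set => // [i|i j iS jS]; first exact: sqr_ge0.
  rewrite -[leLHS]real_normK ?num_real // -[leRHS]real_normK ?num_real //.
  by rewrite ler_sqr ?nnegrE //; exact: topS.
have uT : `|c| * vnorm (restr T v) <= vnorm (restr T u) + vnorm (restr T z).
  have := vnormD (restr T u) ((-1) *: restr T z).
  rewrite vnormZ normrN1 mul1r uE restrD restrZ.
  by rewrite scaleN1r addrK vnormZ.
have uS : vnorm (restr S u) <= `|c| * vnorm (restr S v) + vnorm (restr S z).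
  by rewrite uE restrD restrZ -vnormZ vnormD.
by lra.
Qed.

(* Davis-Kahan: the component d of e orthogonal to the restriction w of v
   satisfies [lam * vdot d d = vdot d (W *m e) <= c * vnorm d], since the spike
   term is killed by d. *)
Lemma spike_sin_angle S e c : top_eigvec_padded G S e ->
  specnorm_le W S c -> 0 < c -> c < theta * vdot (restr S v) (restr S v) ->
  Num.sqrt (1 - vdot e v ^+ 2) <= Num.sqrt (1 - vdot (restr S v) (restr S v))
    + c / (theta * vdot (restr S v) (restr S v) - c).
Proof.
move=> Se Wc c0 ctau; set tau := vdot (restr S v) _ in ctau *.
have tau0 : 0 < tau.
  by rewrite -(pmulr_rgt0 _ theta_gt0); apply: lt_trans ctau.
have [lam [eS e1 eig lam_ge _]] := spike_top_eigvec Se Wc tau0.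
set w := restr S v in tau tau0 ctau lam_ge *; rewrite -/tau in lam_ge.
have wS : supported S w by exact: restr_supported.
have vw x : supported S x -> vdot v x = vdot w x.
  by move=> Sx; rewrite vdot_restr_supported.
(* [a *: w] is the orthogonal projection of [e] onto the line of [w]. *)
pose a := vdot w e / tau.
have [d dE] : exists d, d = e - a *: w by eexists.
have aw : vdot w e = a * tau by rewrite /a divfK // gt_eqF.
have wd : vdot w d = 0 by rewrite dE !vdotE aw -/tau; ring.
have dS : supported S d by rewrite dE -scaleNr; apply: supportedD => //; apply: supportedZ.
have dd : vdot d d = 1 - a ^+ 2 * tau.
  by rewrite dE !vdotE -sqr_vnorm e1 [vdot e w]vdotC aw -/tau; ring.
have de : vdot d e = vdot d d.
  by rewrite {2}dE !vdotE wd [vdot e d]vdotC; ring.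
have tau1 : tau <= 1.
  rewrite -v1 /tau /w vdotxx_restr vdotxx [leRHS](bigID (mem S)) /= lerDl.
  by rewrite sumr_ge0 // => i _; exact: sqr_ge0.
have lam0 : 0 < theta * tau - c by lra.
have d_le : vnorm d <= c / (theta * tau - c).
  have := eig d dS; rewrite spike_mulmx !vdotE [vdot d v]vdotC (vw d dS) wd mulr0 add0r de.
  have := specnorm_le_vdot Wc dS eS; rewrite e1 mulr1 => /ler_normlP[_ h] h'.
  rewrite h' -sqr_vnorm in h; have d0 := vnorm_ge0 d.
  have [->|dn0] := eqVneq (vnorm d) 0; first by rewrite divr_ge0 // ltW.
  have dgt0 : 0 < vnorm d by rewrite lt_def dn0.
  rewrite ler_pdivlMr // -(ler_pM2l dgt0).
  have := ler_wpM2r (sqr_ge0 (vnorm d)) lam_ge.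
  by lra.
(* The two sides differ by exactly [(1 - tau) * vdot d d], which is nonnegative because
   [tau <= 1]. *)
have sin2 : 1 - vdot e v ^+ 2 <= (1 - tau) + vnorm d ^+ 2.
  rewrite vdotC vw // aw sqr_vnorm dd.
  have : 0 <= (1 - tau) * vdot d d by rewrite mulr_ge0 ?subr_ge0 ?vdotxx_ge0.
  by rewrite dd; lra.
apply: (@le_trans _ _ (Num.sqrt (1 - tau) + vnorm d)); last by rewrite lerD2l.
have s0 := sqrtr_ge0 (1 - tau); have d0 := vnorm_ge0 d.
rewrite -[leRHS]ger0_norm ?addr_ge0 // -sqrtr_sqr ler_sqrt ?sqr_ge0 //.
apply: le_trans sin2 _; rewrite sqrrD (_ : Num.sqrt (1 - tau) ^+ 2 = 1 - tau).
  by have := mulr_ge0 s0 d0; lra.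
by rewrite sqr_sqrtr ?subr_ge0.
Qed.

End Spike.

(** * Induction along the run, with [g] in the role of the square root of gamma *)

Section SEP.
Variables (R : realType) (n : nat) (v : 'cV[R]_n) (theta g : R) (G W : 'M[R]_n).
Hypotheses (theta_gt0 : 0 < theta) (Gsym : G^T = G) (v1 : vdot v v = 1).
Hypothesis GW : G = theta *: (v *m v^T) + W.
Hypothesis g01 : 0 < g < 1.
Variables (k : nat) (eps : nat -> R).
Hypothesis kn : (k <= n)%N.
Hypothesis specW : forall S : {set 'I_n}, (0 < #|S|)%N -> specnorm_le W S (eps #|S|).
Hypothesis eps_ge0 : forall p, 0 <= eps p.
Hypothesis eps_le : forall p q, (p <= 4 * q)%N -> eps p <= 2 * eps q.
Hypothesis eps_small : forall p, (0 < p)%N -> (p <= k)%N ->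
  8 * eps p <= theta * g ^+ 2 * (1 - g) * (sfun v p)^-1.

(** Each diagonal entry is [theta * v_i^2] up to [eps 1], so the largest one loses at most
    [2 * eps 1] against the best index [i]. *)
Lemma SEP_first_mass j : (0 < k)%N -> (forall i, `|G i i| <= `|G j j|) ->
  g ^+ 2 * (sfun v 1)^-1 <= vdot (restr [set j] v) (restr [set j] v).
Proof.
move=> k0 jmax; have n0 := leq_trans k0 kn.
have [B [cB _]] := sorted_abs_top_set v n0.
have /cards1P[i ->] : #|B| == 1%N by rewrite cB.
rewrite big_set1 vdotxx_restr big_set1 => T1.
have Wd l : `|W l l| <= eps 1.
  have := @specW [set l]; rewrite cards1 => /(_ isT) /specnorm_le_diag; apply.
  by rewrite inE.
have := eps_small (leqnn 1) k0; rewrite -T1.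
have := jmax i; rewrite !(spike_diag GW).
have := Wd i; have := Wd j; rewrite !ler_norml => /andP[j1 j2] /andP[i1 i2].
have vj := sqr_ge0 (v j 0); have vi := sqr_ge0 (v i 0).
have tj := mulr_ge0 (ltW theta_gt0) vj; have ti := mulr_ge0 (ltW theta_gt0) vi.
move=> /andP[_ ij] small.
have ji : theta * v i 0 ^+ 2 + W i i <= theta * v j 0 ^+ 2 + eps 1.
  apply: le_trans ij _.
  by rewrite ler_norml; apply/andP; split; lra.
case/andP: g01 => g0 g1.
(* The slack factors as [(1 - g) * (1 + g - g ^+ 2 / 4)]. *)
have c1 : g ^+ 2 + g ^+ 2 * (1 - g) / 4 <= 1.
  have h : 0 <= 1 + g - g ^+ 2 / 4 by nra.
  have := mulr_ge0 (_ : 0 <= 1 - g) h; rewrite subr_ge0 => /(_ (ltW g1)); lra.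
have := ler_wpM2l ti c1 => hh.
rewrite -(ler_pM2l theta_gt0); lra.
Qed.

(** The selected set is compared with an optimal [T] of size [p.+1]. With [a = theta |<v, e>|],
    [x = |v_T|] and [y = |v_S'|], selection gives [a * x <= a * y + 4 * eps p], and the aim is
    [g * x <= y]. *)
Lemma SEP_step_mass p (S S' : {set 'I_n}) e : (0 < p)%N -> (p < k)%N ->
  #|S| = p -> #|S'| = p.+1 ->
  top_eigvec_padded G S e -> top_set (fun i => `|(G *m e) i 0|) S' ->
  g ^+ 2 * (sfun v p)^-1 <= vdot (restr S v) (restr S v) ->
  g ^+ 2 * (sfun v p.+1)^-1 <= vdot (restr S' v) (restr S' v).
Proof.
move=> p0 pk cS cS' Se topS' tau_ge.
have pn := leq_trans (ltnW pk) kn; have p1n := leq_trans pk kn.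
have T0 := sfun_inv_gt0 v1 p0 pn; have TT := sfun_inv_le v (leqnSn p) p1n.
have small := eps_small p0 (ltnW pk); have e0 := eps_ge0 p.
case/andP: g01 => g0 g1; have g2 := exprn_gt0 2 g0.
have [T [cT _ TE]] := sorted_abs_top_set v p1n.
rewrite -vdotxx_restr in TE; rewrite -TE in TT *.
have tau0 : 0 < vdot (restr S v) (restr S v).
  by apply: lt_le_trans tau_ge; rewrite mulr_gt0.
have WS : specnorm_le W S (eps p) by rewrite -cS; apply: specW; rewrite cS.
have [lam [eS e1 _ lam1 lam2]] := spike_top_eigvec Gsym GW Se WS tau0.
have noise (Z : {set 'I_n}) : #|Z| = p.+1 -> vnorm (restr Z (W *m e)) <= 2 * eps p.
  (* The union has at most [2 * p + 1 <= 4 * p] elements, as [p] is positive; the factor 4 becomes 2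
     under the square root in [eps]. *)
  move=> cZ; have cU : (0 < #|S :|: Z| <= 4 * p)%N.
    have := cardsU S Z; have := subset_leq_card (subsetUl S Z).
    by rewrite cS cZ; lia.
  case/andP: cU => cU0 cU.
  have := vnorm_restr_mulmx (specW cU0) (eps_ge0 _) (subsetUr S Z)
    (supportedW (subsetUl S Z) eS).
  by rewrite e1 mulr1 => h; apply: le_trans h _; apply: eps_le.
have := spike_select (spike_mulmx GW e) topS' _ (noise _ cT) (noise _ cS').
rewrite cT cS' => /(_ (leqnn _)).
set a := `|_|; have a0 : 0 <= a by exact: normr_ge0.
have aE : a ^+ 2 = theta * (theta * vdot v e ^+ 2).
  by rewrite /a real_normK ?num_real //; ring.
have xE := sqr_vnorm (restr T v); have yE := sqr_vnorm (restr S' v).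
have x0 := vnorm_ge0 (restr T v); have y0 := vnorm_ge0 (restr S' v).
rewrite -xE in TT *; rewrite -yE.
move: (vnorm (restr T v)) (vnorm (restr S' v)) x0 y0 TT => x y x0 y0 TT sel {xE yE TE noise}.
set t := (sfun v p)^-1 in T0 TT tau_ge small *.
(* The eigenvalue bounds lose [2 * eps p], at most a quarter of [theta * g ^+ 2 * t]; hence the
   factor 3/4. *)
have a2 : theta ^+ 2 * g ^+ 2 * t * (3 / 4) <= a ^+ 2.
  rewrite aE; have : g ^+ 2 * t * theta * (3/4) <= theta * vdot v e ^+ 2.
    have := ler_wpM2l (ltW theta_gt0) tau_ge.
    have : theta * g ^+ 2 * (1 - g) * t <= theta * g ^+ 2 * t.
      apply: ler_wpM2r; first exact: ltW.
      by rewrite ger_pMr ?mulr_gt0 //; lra.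
    by lra.
  by move/(ler_wpM2l (ltW theta_gt0)); lra.
have agt0 : 0 < a.
  have tp : 0 < theta ^+ 2 * g ^+ 2 * t * (3 / 4).
    by rewrite !mulr_gt0 ?exprn_gt0 //; lra.
  by rewrite lt_def a0 andbT; apply/eqP => a00; move: a2; rewrite a00; lra.
suff gxy : g * x <= y.
  by rewrite -exprMn ler_sqr ?nnegrE // mulr_ge0 // ltW.
suff : 4 * eps p <= a * ((1 - g) * x).
  by move=> h; rewrite -(ler_pM2l agt0); lra.
have h0 : 0 <= a * ((1 - g) * x) by rewrite !mulr_ge0 //; lra.
(* Squaring allows the use of [a2] and of [t <= x ^+ 2]; what remains is a square times
   [3 - g ^+ 2]. *)
rewrite -ler_sqr ?nnegrE //; last by rewrite mulr_ge0.
apply: (@le_trans _ _ ((theta * g ^+ 2 * (1 - g) * t / 2) ^+ 2)).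
  have small2 : 4 * eps p <= theta * g ^+ 2 * (1 - g) * t / 2 by lra.
  have eps4 : 0 <= 4 * eps p by rewrite mulr_ge0.
  by rewrite ler_sqr ?nnegrE // (le_trans eps4).
apply: (@le_trans _ _ (theta ^+ 2 * g ^+ 2 * t * (3 / 4) * ((1 - g) ^+ 2 * t))); last first.
  rewrite !exprMn; apply: ler_pM => //.
  - by rewrite !mulr_ge0 ?ltW ?exprn_gt0 //; lra.
  - by rewrite mulr_ge0 ?sqr_ge0 // ltW.
  - by rewrite ler_wpM2l ?sqr_ge0.
rewrite -subr_ge0.
have -> : theta ^+ 2 * g ^+ 2 * t * (3 / 4) * ((1 - g) ^+ 2 * t) -
  (theta * g ^+ 2 * (1 - g) * t / 2) ^+ 2 =
  (theta * g * t * (1 - g) / 2) ^+ 2 * (3 - g ^+ 2) by field.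
rewrite mulr_ge0 ?sqr_ge0 //; nra.
Qed.

(** The size is carried through the induction because the noise level [eps] depends on it. *)
Lemma SEP_mass Ssup vhat p : SEP_run G k Ssup vhat -> (0 < p)%N -> (p <= k)%N ->
  #|Ssup p| = p /\
  g ^+ 2 * (sfun v p)^-1 <= vdot (restr (Ssup p) v) (restr (Ssup p) v).
Proof.
move=> [[j [S1 jmax]] step _]; elim: p => // -[|p] IHp _ pk.
  by rewrite S1 cards1; split=> //; exact: SEP_first_mass.
have [cS mass] := IHp isT (ltnW pk).
have [|e [Se [cS' top]]] := step p.+1 isT; first lia.
by split=> //; apply: SEP_step_mass cS cS' Se top mass.
Qed.

End SEP.

(** * Symmetry of the sample matrix and assembly of the theorem *)

Lemma Gammahat_sym (R : realType) n m (x : 'I_m -> 'cV[R]_n) :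
  (Gammahat x)^T = Gammahat x.
Proof.
rewrite /Gammahat linearB /= linearZ /= trmx1 raddf_sum /=.
by under eq_bigr => i _ do rewrite trmx_mul trmxK.
Qed.

Theorem theorem1 (R : realType) (C0 : R) (hC0 : 0 < C0) :
  exists C1 C2 : R, 0 < C1 /\ 0 < C2 /\
  forall (n m k : nat) (theta gamma : R) (v : 'cV[R]_n)
         (x : 'I_m -> 'cV[R]_n),
    (2 <= n)%N -> (1 <= m)%N -> (1 <= k)%N -> (k <= n)%N -> 0 < theta ->
    vnorm v = 1 ->
    (#|[set i | (v i ord0 != 0)%R]| <= k)%N ->
    eventE C0 x theta v ->
    0 < gamma < 1 ->
    m%:R >= C1 * (1 + theta) ^+ 2
              / (theta ^+ 2 * gamma ^+ 2 * (1 - Num.sqrt gamma) ^+ 2)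
              * (\big[Num.max/0]_(1 <= p < k.+1) (p%:R * sfun v p ^+ 2))
              * ln (n%:R) ->
    forall (Ssup : nat -> {set 'I_n}) (vhat : 'cV[R]_n),
      SEP_run (Gammahat x) k Ssup vhat ->
      vnorm (restr (Ssup k) v) >= Num.sqrt gamma /\
      Num.sqrt (1 - vdot vhat v ^+ 2)
        <= Num.sqrt (1 - gamma)
           + C2 * (1 + theta) / (theta * gamma)
             * Num.sqrt (k%:R * ln (n%:R) / m%:R).
Proof.
(* 64 is the square of the 8 in [eps_small]; the 2 absorbs the subtraction of [eps k] in the
   Davis-Kahan denominator. *)
exists (64 * C0 ^+ 2), (2 * C0); split; first by rewrite mulr_gt0 ?exprn_gt0 //; lra.
split; first by rewrite mulr_gt0 //; lra.
move=> n m k theta gamma v x n2 m1 k1 kn theta0 vn1 vk evE gam01 mlarge Ssup vhat run.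
have /andP[gam0 gam1] := gam01.
have v1 : vdot v v = 1 by rewrite -sqr_vnorm vn1 expr1n.
set g := Num.sqrt gamma in mlarge *.
have g2 : g ^+ 2 = gamma by rewrite sqr_sqrtr // ltW.
have g0 : 0 < g by rewrite sqrtr_gt0.
have g1 : g < 1 by rewrite -(@ltr_pXn2r _ 2) ?nnegrE ?ltW // g2 expr1n.
have m0 : 0 < m%:R :> R by rewrite ltr0n.
have L0 : 0 < ln (n%:R : R) by rewrite ln_gt0 // ltr1n.
set L := ln (n%:R : R) in mlarge L0 *.
pose eps p : R := C0 * (1 + theta) * Num.sqrt (p%:R * L / m%:R).
have pos p : 0 <= p%:R * L / m%:R :> R.
  by rewrite divr_ge0 ?mulr_ge0 // ltW.
have C0t : 0 < C0 * (1 + theta) by rewrite mulr_gt0 //; lra.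
have eps0 p : 0 <= eps p by rewrite mulr_ge0 ?sqrtr_ge0 // ltW.
have eps_le p q : (p <= 4 * q)%N -> eps p <= 2 * eps q.
  move=> pq; rewrite /eps mulrCA; apply: ler_wpM2l; first exact: ltW.
  have s0 r := sqrtr_ge0 (r%:R * L / m%:R : R).
  rewrite -(@ler_pXn2r _ 2) ?nnegrE ?mulr_ge0 // exprMn !sqr_sqrtr //.
  have -> : (2 : R) ^+ 2 = 4%:R by ring.
  rewrite !mulrA -natrM ler_pM2r ?invr_gt0 // ler_pM2r //.
  by rewrite ler_nat.
have eps_small p : (0 < p)%N -> (p <= k)%N ->
    8 * eps p <= theta * g ^+ 2 * (1 - g) * (sfun v p)^-1.
  (* The maximum [B] dominates the term at [p]; after squaring and clearing denominators, the claim
     is the hypothesis on [m]. *)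
  move=> p0 pk; set B := (\big[_/_]_(_ <= _ < _) _) in mlarge.
  have Bp : p%:R * sfun v p ^+ 2 <= B.
    rewrite /B; apply: (@le_bigmax_seq _ _ _ _ _ p xpredT) => //.
    by rewrite mem_index_iota; lia.
  have := sfun_inv_gt0 v1 p0 (leq_trans pk kn); rewrite invr_gt0.
  move: (sfun v p) Bp => s Bp s0.
  have D0 : 0 < theta * gamma * (1 - g) by rewrite !mulr_gt0 // subr_gt0.
  have D2 := exprn_gt0 2 D0.
  rewrite g2 -(@ler_pXn2r _ 2 isT) ?nnegrE; last 2 first.
  - by rewrite mulr_ge0.
  - by rewrite divr_ge0 // ltW.
  rewrite expr_div_n ler_pdivlMr ?exprn_gt0 // /eps !exprMn sqr_sqrtr //.
  rewrite -!exprMn.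
  set D := (_ * _ * (1 - g)) ^+ 2 in D2 *.
  have K0 : 0 <= 64 * C0 ^+ 2 * (1 + theta) ^+ 2 * L.
    by apply: mulr_ge0 (ltW L0); rewrite -mulrA -exprMn mulr_ge0 ?sqr_ge0.
  have := ler_wpM2l K0 Bp.
  move: mlarge; rewrite -!exprMn -/D => mlarge KB.
  rewrite -(ler_pM2r m0).
  have -> : 8 ^+ 2 * ((C0 * (1 + theta)) ^+ 2 * (p%:R * L / m%:R)) * s ^+ 2 * m%:R
    = 64 * C0 ^+ 2 * (1 + theta) ^+ 2 * L * (p%:R * s ^+ 2).
    by field; rewrite gt_eqF.
  apply: le_trans KB _; rewrite -ler_pdivrMl //.
  apply: le_trans mlarge; rewrite le_eqVlt; apply/orP; left; apply/eqP; ring.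
have GW : Gammahat x = theta *: (v *m v^T) + Wmat x theta v.
  by rewrite /Wmat addrC subrK.
have g01 : 0 < g < 1 by rewrite g0.
have [cS mass] := SEP_mass theta0 (Gammahat_sym x) v1 GW g01 kn evE eps0 eps_le eps_small run k1 (leqnn k).
have Tk := sfun_inv_eq1 v1 kn vk; rewrite Tk mulr1 g2 in mass.
have small := eps_small k k1 (leqnn k); rewrite Tk mulr1 g2 in small.
split; first by rewrite vnormE ler_sqrt // vdotxx_ge0.
have [_ _ Sv] := run.
have epsk0 : 0 < eps k.
  by rewrite mulr_gt0 // sqrtr_gt0 divr_gt0 // mulr_gt0 // ltr0n.
have tg : 0 < theta * gamma by rewrite mulr_gt0.
have small2 : 8 * eps k <= theta * gamma.
  by apply: le_trans small _; rewrite ger_pMr //; lra.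
have mt := ler_wpM2l (ltW theta0) mass.
have WS : specnorm_le (Wmat x theta v) (Ssup k) (eps k).
  by rewrite -{2}cS; apply: evE; rewrite cS.
have := spike_sin_angle theta0 (Gammahat_sym x) v1 GW Sv WS epsk0.
move=> /(_ ltac:(lra)) h; apply: le_trans h _; apply: lerD.
  by rewrite ler_sqrt //; lra.
(* With [X = 2 * eps k / (theta * gamma)] this reduces to [theta * gamma / 2] being at most the
   denominator, which follows from [mt] and [small2]. *)
rewrite ler_pdivrMr; last lra.
set X := (X in _ <= X * _).
have -> : X = 2 * eps k / (theta * gamma) by rewrite /X /eps; ring.
rewrite -ler_pdivrMl; last by rewrite divr_gt0 // mulr_gt0.
have -> : (2 * eps k / (theta * gamma))^-1 * eps k = theta * gamma / 2.
  by field; rewrite !gt_eqF.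
lra.
Qed.
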